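(* Let $(G,+)$ be a group (not necessarily abelian) with identity $0_G$, let $R$ be a reflexive relation on $G$, and let $A,B$ be nonempty subsets of $G$. Assume that $R$ is transitive and isotone and satisfies property (P4) (relative to $B$), and that $A$ is finite. If $B=\{b^1,\dots,b^m\}$, $m\geq 2$, with $b^iI0_G$ for each $i=1,\dots,m$, then $\mathscr{E}(A+B)\neq\mathscr{E}(A)$.
   Context: For $x,y\in G$, $xPy$ means that $xRy$ holds and $yRx$ does not; $xIy$ means that neither $xRy$ nor $yRx$ holds. $R$ is isotone if for all $g,g',z\in G$, $gRg'$ implies $(z+g)R(z+g')$ and $(g+z)R(g'+z)$. For an integer $p\geq 1$ and $g\in G$, $pg$ is the sum of $p$ copies of $g$. Superscripts on points are labels, not powers. Property (P4): for every $q\geq 1$, all integers $p_1,\dots,p_q\geq 1$ and all $c^1,\dots,c^q\in B$, $(p_1c^1+\dots+p_qc^q)R0_G$ implies that at least one $c^l$ satisfies $c^lR0_G$. The sum set is $A+B=\{a+b: a\in A, b\in B\}$. For $S\subseteq G$, $\mathscr{E}(S)$ is the set of efficient points of $S$, i.e. of those $g\in S$ for which there is no $g'\in S$ with $g'Pg$; by convention $\mathscr{E}(\emptyset)=\emptyset$. *)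

(* Defs.v *)
From mathcomp Require Import all_boot.
From mathcomp Require Import boolp classical_sets functions cardinality.
From Corelib Require Import RelationClasses.

Set Implicit Arguments.
Unset Strict Implicit.
Unset Printing Implicit Defensive.

Local Open Scope classical_set_scope.
Local Open Scope group_scope.

(* The library's additive groups are all commutative, so the additive but not
   necessarily abelian group (G, +, 0) is a groupType, in multiplicative notation:
   x * y stands for x + y, 1 for 0, and g ^+ p for pg. *)

Definition strictPart (G : Type) (R : G -> G -> Prop) (x y : G) : Prop :=
  R x y /\ ~ R y x.

Definition incomparable (G : Type) (R : G -> G -> Prop) (x y : G) : Prop :=
  ~ R x y /\ ~ R y x.

Definition isotone (G : groupType) (R : G -> G -> Prop) : Prop :=
  forall g g' z : G, R g g' -> R (z * g) (z * g') /\ R (g * z) (g' * z).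

(* The order matters: the iterated product is taken in increasing order of the index. *)
Definition P4 (G : groupType) (R : G -> G -> Prop) (B : set G) : Prop :=
  forall (q : nat) (p : 'I_q -> nat) (c : 'I_q -> G),
    (1 <= q)%N -> (forall l, (1 <= p l)%N) -> (forall l, B (c l)) ->
    R (\prod_(l < q) c l ^+ p l) 1 -> exists l, R (c l) 1.

Definition sumset (G : groupType) (A B : set G) : set G :=
  [set a * b | a in A & b in B].

Definition efficient (G : Type) (R : G -> G -> Prop) (S : set G) : set G :=
  [set g | S g /\ ~ exists2 g', S g' & strictPart R g' g].

(* Main.v *)
Require Import Defs.
From mathcomp Require Import all_boot.
From mathcomp Require Import boolp classical_sets functions cardinality.
From Corelib Require Import RelationClasses.

(** The two efficient sets cannot agree because equality would let every
    efficient point of [A] be divided by an element of [B] forever, inside a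
    finite set.

    Suppose they agree, and let [x] be efficient in [A]. Then [x] is efficient
    in the sum set, so [x = a * c] with [a] in [A] and [c] in [B]. The point [a]
    is again efficient in [A]: otherwise some [e] in [A] strictly dominates [a],
    and since translations preserve and reflect strict dominance, [e * c]
    strictly dominates [x] in the sum set ([efficient_sumset_factor]).

    Say that [y] divides [x] when [x = y * c_1 * ... * c_q] for some [q >= 1] and
    [c_l] in [B]. This relation is transitive, and (P4) makes it irreflexive
    ([divides_irrefl]): [x] dividing itself means [c_1 * ... * c_q = 1], whence
    [R (c_l) 1] for some [l], which is excluded for elements of [B]. A transitive
    irreflexive relation has a minimal point on any nonempty finite set
    ([finite_minimal]). Applied to strict dominance on [A], this makes the
    efficient set of [A] nonempty; applied to divisibility on that efficient
    set, it contradicts the previous paragraph. *)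

Local Open Scope classical_set_scope.
Local Open Scope group_scope.

(** Scanning an enumeration once suffices: when the next entry lies below the
    current minimal point it replaces it, and transitivity keeps the entries
    already scanned from lying below the new one. *)
Lemma finite_minimal (T : choiceType) (L : T -> T -> Prop) (S : set T) :
  Transitive L -> Irreflexive L -> finite_set S -> S !=set0 ->
  exists2 e, S e & ~ exists2 y, S y & L y e.
Proof.
move=> Ltr Lirr /finite_seqP[s ->] [a /= a_s].
suff [e eP emin] : exists2 e, e = a \/ e \in s & forall y, y \in s -> ~ L y e.
  exists e; last by move=> [y ys]; exact: emin.
  by case: eP => [->|].
elim: s {a_s} => [|x s [e eP emin]]; first by exists a; [left|].
have [Lxe|nLxe] := pselect (L x e).
- exists x; first by right; rewrite mem_head.
  move=> y; rewrite inE => /orP[/eqP ->|ys Lyx]; first exact: Lirr.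
  exact: emin ys (Ltr _ _ _ Lyx Lxe).
- exists e; first by case: eP => [->|es]; [left|right; rewrite inE es orbT].
  by move=> y; rewrite inE => /orP[/eqP ->|/emin].
Qed.

Lemma strictPart_trans (T : Type) (R : T -> T -> Prop) :
  Transitive R -> Transitive (strictPart R).
Proof.
move=> Rtr x y z [Rxy nRyx] [Ryz nRzy]; split; first exact: Rtr Rxy Ryz.
by move=> Rzx; apply: nRzy; exact: Rtr Rzx Rxy.
Qed.

Lemma efficient_neq0 (T : choiceType) (R : T -> T -> Prop) (S : set T) :
  Transitive R -> finite_set S -> S !=set0 -> efficient R S !=set0.
Proof.
move=> Rtr Sfin S0.
have [|e Se emin] := finite_minimal _ (strictPart R) _ (strictPart_trans _ _ Rtr)
  _ Sfin S0; first by move=> x [].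
by exists e.
Qed.

(** Isotony for the inverse translation makes the translation reflect [R], so
    that strictness survives. *)
Lemma strictPart_mulr (G : groupType) (R : G -> G -> Prop) (x y z : G) :
  isotone R -> strictPart R x y -> strictPart R (x * z) (y * z).
Proof.
move=> Riso [Rxy nRyx]; split; first by have [] := Riso _ _ z Rxy.
move=> Ryx; apply: nRyx.
by have [_] := Riso _ _ z^-1 Ryx; rewrite !mulgK.
Qed.

Lemma efficient_sumset_factor (G : groupType) (R : G -> G -> Prop)
    (A B : set G) (x : G) :
  isotone R -> efficient R (sumset A B) x ->
  exists2 a, efficient R A a & exists2 c, B c & x = a * c.
Proof.
move=> Riso [[a Aa [c Bc <-]] nondom]; exists a; last by exists c.
split=> // -[e Ae dom_ea]; apply: nondom; exists (e * c).
  by exists e => //; exists c.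
exact: strictPart_mulr.
Qed.

(** The factors form a sequence because their order matters in [G]. *)
Definition divides {G : groupType} (B : set G) (y x : G) : Prop :=
  exists s : seq G,
    [/\ s != [::], forall c, c \in s -> B c & x = y * \prod_(c <- s) c].

Lemma divides_trans (G : groupType) (B : set G) : Transitive (divides B).
Proof.
move=> x y z [s [s0 sB ->]] [t [t0 tB ->]]; exists (s ++ t); split.
- by case: s s0 {sB}.
- by move=> c; rewrite mem_cat => /orP[/sB|/tB].
- by rewrite big_cat /= mulgA.
Qed.

(** This is (P4) with all multiplicities equal to [1]: the factors in (P4) may
    repeat, so an arbitrary word in [B] is already of the required form. *)
Lemma divides_irrefl (G : groupType) (R : G -> G -> Prop) (B : set G) :
  Reflexive R -> P4 R B -> (forall c, B c -> ~ R c 1) ->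
  Irreflexive (divides B).
Proof.
move=> Rrefl RP4 BnR x [s [s0 sB xE]].
have prod1 : \prod_(c <- s) c = 1.
  by apply: (mulgI x); rewrite mulg1 -xE.
have tB l : B (tnth (in_tuple s) l) by apply: sB; exact: mem_tnth.
have [|||l] := RP4 (size s) (fun=> 1%N) (tnth (in_tuple s)) _ _ tB.
- by rewrite lt0n size_eq0.
- by [].
- under eq_bigr do rewrite expg1.
  by move: prod1; rewrite (big_tnth _ _ s) => ->; exact: Rrefl.
- exact: BnR.
Qed.

Theorem theorem8 (G : groupType) (R : G -> G -> Prop) (A B : set G)
    (R_refl : Reflexive R) (A_neq0 : A !=set0) (B_neq0 : B !=set0)
    (R_trans : Transitive R) (R_iso : isotone R) (R_P4 : P4 R B)
    (A_fin : finite_set A)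
    (m : nat) (b : 'I_m -> G) (m_ge2 : (2 <= m)%N) (b_inj : injective b)
    (B_enum : B = range b) (b_inc : forall i, incomparable R (b i) 1) :
  efficient R (sumset A B) <> efficient R A.
Proof.
move=> effE.
have BnR c : B c -> ~ R c 1.
  by rewrite B_enum => -[i _ <-]; have [] := b_inc i.
have eff_fin : finite_set (efficient R A).
  by apply: sub_finite_set A_fin => x [].
have [x eff_x xmin] := finite_minimal _ _ _ (divides_trans _ B)
  (divides_irrefl _ _ _ R_refl R_P4 BnR) eff_fin
  (efficient_neq0 _ _ _ R_trans A_fin A_neq0).
have [a eff_a [c Bc xE]] : exists2 a, efficient R A a & exists2 c, B c & x = a * c.
  by apply: efficient_sumset_factor R_iso _; rewrite effE.
apply: xmin; exists a => //; exists [:: c]; split=> //.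
  by move=> y; rewrite inE => /eqP ->.
by rewrite big_seq1.
Qed.
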